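(* Let $X$ be a preorder. A morphism $p\colon E\to B$ in the category $\mathsf{Ord}_X$ of $X$-filtered preorders is an effective descent morphism in $\mathsf{Ord}_X$ if and only if both of the following hold: (a) for all $b_2\leqslant b_1\leqslant b_0$ in $B$, there exist $e_2\leqslant e_1\leqslant e_0$ in $E$ with $p(e_i)=b_i$ for each $i=0,1,2$; (b) for each $x\in X$ and all $b_1\leqslant b_0$ in $B_x$, there exist $e_1\leqslant e_0$ in $E_x$ with $p(e_i)=b_i$ for each $i=0,1$.
   Context: A preorder is a set equipped with a reflexive transitive relation $\leqslant$; $\mathsf{Ord}$ is the category of preorders and monotone maps; $X$ is a fixed preorder. An $X$-filtered preorder is a pair $(A,\mathsf{a})$ where $A$ is a preorder and $\mathsf{a}\subseteq X\times A$ is a relation such that $x'\leqslant x$, $a\leqslant a'$ and $(x,a)\in\mathsf{a}$ imply $(x',a')\in\mathsf{a}$. Equivalently, it is a preorder $A$ equipped with a family $(A_x)_{x\in X}$ of up-closed subsets of $A$ such that $x'\leqslant x\Rightarrow A_x\subseteq A_{x'}$; the correspondence is $A_x=\{a\in A\mid (x,a)\in\mathsf{a}\}$. One writes simply $A=(A,\mathsf{a})=(A,(A_x)_{x\in X})$. A morphism $f\colon A\to B$ in $\mathsf{Ord}_X$ is a monotone map $f\colon A\to B$ with $f(A_x)\subseteq B_x$ for all $x\in X$. In a category $\mathcal{C}$ with pullbacks, a morphism $p\colon E\to B$ is an effective descent morphism if the pullback functor $p^*\colon(\mathcal{C}\downarrow B)\to(\mathcal{C}\downarrow E)$ is monadic,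 i.e. the comparison functor from $(\mathcal{C}\downarrow B)$ to the category of algebras of the monad on $(\mathcal{C}\downarrow E)$ induced by $p_!\dashv p^*$ is an equivalence of categories. *)

(* Defs.v *)
From Stdlib Require Import RelationClasses FunctionalExtensionality ProofIrrelevance.

Set Implicit Arguments.
Unset Strict Implicit.
Unset Printing Implicit Defensive.

Declare Scope cat_scope.
Delimit Scope cat_scope with cat.
Local Open Scope cat_scope.

Reserved Notation "g ∘ f" (at level 40, left associativity).

Record Category : Type := MkCategory {
  Obj :> Type;
  Hom : Obj -> Obj -> Type;
  idm : forall A : Obj, Hom A A;
  comp : forall A B C : Obj, Hom B C -> Hom A B -> Hom A C;
  comp_idl : forall (A B : Obj) (f : Hom A B), comp (idm B) f = f;
  comp_idr : forall (A B : Obj) (f : Hom A B), comp f (idm A) = f;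
  comp_assoc : forall (A B C D : Obj) (h : Hom C D) (g : Hom B C) (f : Hom A B),
    comp h (comp g f) = comp (comp h g) f
}.

Arguments Hom {_} A B.
Arguments idm {_} A.
Arguments comp {_ A B C} g f.
Notation "g ∘ f" := (comp g f) : cat_scope.

Record Functor (C D : Category) : Type := MkFunctor {
  fobj :> C -> D;
  fmap : forall A B : C, Hom A B -> Hom (fobj A) (fobj B);
  fmap_id : forall A : C, fmap (idm A) = idm (fobj A);
  fmap_comp : forall (A B A' : C) (g : Hom B A') (f : Hom A B),
    fmap (g ∘ f) = fmap g ∘ fmap f
}.
Arguments fmap {C D} F {A B} f : rename.

Definition functor_id (C : Category) : Functor C C :=
  {| fobj := fun A => A;
     fmap := fun _ _ f => f;
     fmap_id := fun _ => eq_refl;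
     fmap_comp := fun _ _ _ _ _ => eq_refl |}.

Section FunctorComp.
Variables (C D E : Category) (G : Functor D E) (F : Functor C D).

Lemma functor_comp_id (A : C) : fmap G (fmap F (idm A)) = idm (G (F A)).
Proof. now rewrite !fmap_id. Qed.

Lemma functor_comp_comp (A B A' : C) (g : Hom B A') (f : Hom A B) :
  fmap G (fmap F (g ∘ f)) = fmap G (fmap F g) ∘ fmap G (fmap F f).
Proof. now rewrite !fmap_comp. Qed.

Definition functor_comp : Functor C E :=
  {| fobj := fun A => G (F A);
     fmap := fun _ _ f => fmap G (fmap F f);
     fmap_id := functor_comp_id;
     fmap_comp := functor_comp_comp |}.
End FunctorComp.

Record NatTrans (C D : Category) (F G : Functor C D) : Type := MkNatTrans {
  component :> forall A : C, Hom (F A) (G A);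
  naturality : forall (A B : C) (f : Hom A B),
    component B ∘ fmap F f = fmap G f ∘ component A
}.

Definition is_iso (C : Category) (A B : C) (f : Hom A B) : Prop :=
  exists g : Hom B A, g ∘ f = idm A /\ f ∘ g = idm B.

Definition nat_isomorphic (C D : Category) (F G : Functor C D) : Prop :=
  exists alpha : NatTrans F G, forall A : C, is_iso (alpha A).

Definition is_equivalence (C D : Category) (F : Functor C D) : Prop :=
  exists G : Functor D C,
    nat_isomorphic (functor_comp G F) (functor_id C) /\
    nat_isomorphic (functor_comp F G) (functor_id D).

Record Adjunction (C D : Category) (F : Functor C D) (U : Functor D C) : Type :=
  MkAdjunction {
  adj_unit : NatTrans (functor_id C) (functor_comp U F);
  adj_counit : NatTrans (functor_comp F U) (functor_id D);
  adj_triangle_l : forall A : C, adj_counit (F A) ∘ fmap F (adj_unit A) = idm (F A);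
  adj_triangle_r : forall B : D, fmap U (adj_counit B) ∘ adj_unit (U B) = idm (U B)
}.

Record Monad (C : Category) : Type := MkMonad {
  monad_functor :> Functor C C;
  ret : NatTrans (functor_id C) monad_functor;
  join : NatTrans (functor_comp monad_functor monad_functor) monad_functor;
  join_ret : forall A : C, join A ∘ ret (monad_functor A) = idm (monad_functor A);
  join_fmap_ret : forall A : C,
    join A ∘ fmap monad_functor (ret A) = idm (monad_functor A);
  join_join : forall A : C,
    join A ∘ fmap monad_functor (join A) = join A ∘ join (monad_functor A)
}.

Section AlgebraCategory.
Variables (C : Category) (T : Monad C).

Record Algebra : Type := MkAlgebra {
  alg_obj : C;
  alg_act : Hom (T alg_obj) alg_obj;
  alg_unit : alg_act ∘ ret T alg_obj = idm alg_obj;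
  alg_assoc : alg_act ∘ fmap T alg_act = alg_act ∘ join T alg_obj
}.

Record AlgHom (M N : Algebra) : Type := MkAlgHom {
  alg_hom : Hom (alg_obj M) (alg_obj N);
  alg_hom_comm : alg_hom ∘ alg_act M = alg_act N ∘ fmap T alg_hom
}.

Lemma AlgHom_eq (M N : Algebra) (f g : AlgHom M N) : alg_hom f = alg_hom g -> f = g.
Proof.
destruct f as [f Hf], g as [g Hg]; simpl; intros <-.
f_equal; apply proof_irrelevance.
Qed.

Lemma alg_id_comm (M : Algebra) :
  idm (alg_obj M) ∘ alg_act M = alg_act M ∘ fmap T (idm (alg_obj M)).
Proof. now rewrite fmap_id, comp_idl, comp_idr. Qed.

Lemma alg_comp_comm (M N P : Algebra) (g : AlgHom N P) (f : AlgHom M N) :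
  (alg_hom g ∘ alg_hom f) ∘ alg_act M
  = alg_act P ∘ fmap T (alg_hom g ∘ alg_hom f).
Proof.
now rewrite fmap_comp, comp_assoc, <- alg_hom_comm, <- !comp_assoc, alg_hom_comm.
Qed.

Definition alg_id (M : Algebra) : AlgHom M M :=
  {| alg_hom := idm (alg_obj M); alg_hom_comm := alg_id_comm M |}.

Definition alg_comp (M N P : Algebra) (g : AlgHom N P) (f : AlgHom M N) : AlgHom M P :=
  {| alg_hom := alg_hom g ∘ alg_hom f; alg_hom_comm := alg_comp_comm g f |}.

Definition algebra_category : Category.
Proof.
refine {| Obj := Algebra; Hom := AlgHom; idm := alg_id; comp := alg_comp |}.
- abstract (intros; apply AlgHom_eq, comp_idl).
- abstract (intros; apply AlgHom_eq, comp_idr).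
- abstract (intros; apply AlgHom_eq, comp_assoc).
Defined.
End AlgebraCategory.

Section Comparison.
Variables (C D : Category) (F : Functor C D) (U : Functor D C) (adj : Adjunction F U).

Lemma adj_join_natural (A B : C) (f : Hom A B) :
  fmap U (adj_counit adj (F B)) ∘ fmap U (fmap F (fmap U (fmap F f)))
  = fmap U (fmap F f) ∘ fmap U (adj_counit adj (F A)).
Proof.
rewrite <- !fmap_comp; f_equal.
exact (naturality (adj_counit adj) (fmap F f)).
Qed.

Definition adj_join :
  NatTrans (functor_comp (functor_comp U F) (functor_comp U F)) (functor_comp U F) :=
  MkNatTrans (F := functor_comp (functor_comp U F) (functor_comp U F))
    (G := functor_comp U F)
    (component := fun A : C => fmap U (adj_counit adj (F A))) adj_join_natural.

Definition adjunction_monad : Monad C.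
Proof.
refine {| monad_functor := functor_comp U F;
          ret := adj_unit adj;
          join := adj_join |}.
- abstract (intro A; exact (adj_triangle_r adj (F A))).
- abstract (intro A; simpl; rewrite <- fmap_comp, <- fmap_id; f_equal;
            exact (adj_triangle_l adj A)).
- abstract (intro A; simpl; rewrite <- !fmap_comp; f_equal;
            exact (naturality (adj_counit adj) (adj_counit adj (F A)))).
Defined.

Definition comparison_obj (Y : D) : Algebra adjunction_monad.
Proof.
refine {| alg_obj := U Y : C;
          alg_act := fmap U (adj_counit adj Y) : Hom (adjunction_monad (U Y)) (U Y) |}.
- abstract (exact (adj_triangle_r adj Y)).
- abstract (simpl; rewrite <- !fmap_comp; f_equal;
            exact (naturality (adj_counit adj) (adj_counit adj Y))).
Defined.

Definition comparison_hom (Y Z : D) (f : Hom Y Z) :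
  AlgHom (comparison_obj Y) (comparison_obj Z).
Proof.
refine {| alg_hom := fmap U f : Hom (alg_obj (comparison_obj Y))
                                    (alg_obj (comparison_obj Z)) |}.
abstract (simpl; rewrite <- !fmap_comp; f_equal; symmetry;
          exact (naturality (adj_counit adj) f)).
Defined.

Definition comparison_functor : Functor D (algebra_category adjunction_monad).
Proof.
refine (MkFunctor (D := algebra_category adjunction_monad)
          (fobj := comparison_obj) (fmap := comparison_hom) _ _).
- abstract (intros; apply AlgHom_eq; apply fmap_id).
- abstract (intros; apply AlgHom_eq; apply fmap_comp).
Defined.

Definition is_monadic : Prop := is_equivalence comparison_functor.
End Comparison.

Section SliceCategory.
Variables (C : Category) (B : C).

Record SliceObj : Type := MkSliceObj {
  slice_dom : C;
  slice_map : Hom slice_dom B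
}.

Record SliceHom (M N : SliceObj) : Type := MkSliceHom {
  slice_hom : Hom (slice_dom M) (slice_dom N);
  slice_hom_comm : slice_map N ∘ slice_hom = slice_map M
}.

Lemma SliceHom_eq (M N : SliceObj) (f g : SliceHom M N) :
  slice_hom f = slice_hom g -> f = g.
Proof.
destruct f as [f Hf], g as [g Hg]; simpl; intros <-.
f_equal; apply proof_irrelevance.
Qed.

Definition slice_id (M : SliceObj) : SliceHom M M :=
  {| slice_hom := idm (slice_dom M); slice_hom_comm := comp_idr (slice_map M) |}.

Lemma slice_comp_comm (M N P : SliceObj) (g : SliceHom N P) (f : SliceHom M N) :
  slice_map P ∘ (slice_hom g ∘ slice_hom f) = slice_map M.
Proof. now rewrite comp_assoc, !slice_hom_comm. Qed.

Definition slice_comp (M N P : SliceObj) (g : SliceHom N P) (f : SliceHom M N) :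
  SliceHom M P :=
  {| slice_hom := slice_hom g ∘ slice_hom f; slice_hom_comm := slice_comp_comm g f |}.

Definition slice : Category.
Proof.
refine {| Obj := SliceObj; Hom := SliceHom; idm := slice_id; comp := slice_comp |}.
- abstract (intros; apply SliceHom_eq, comp_idl).
- abstract (intros; apply SliceHom_eq, comp_idr).
- abstract (intros; apply SliceHom_eq, comp_assoc).
Defined.
End SliceCategory.

Record Pullbacks (C : Category) : Type := MkPullbacks {
  pb : forall A B D : C, Hom A D -> Hom B D -> C;
  pb_fst : forall (A B D : C) (f : Hom A D) (g : Hom B D), Hom (pb f g) A;
  pb_snd : forall (A B D : C) (f : Hom A D) (g : Hom B D), Hom (pb f g) B;
  pb_pair : forall (A B D : C) (f : Hom A D) (g : Hom B D) (Z : C)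
    (u : Hom Z A) (v : Hom Z B), f ∘ u = g ∘ v -> Hom Z (pb f g);
  pb_square : forall (A B D : C) (f : Hom A D) (g : Hom B D),
    f ∘ pb_fst f g = g ∘ pb_snd f g;
  pb_fst_pair : forall (A B D : C) (f : Hom A D) (g : Hom B D) (Z : C)
    (u : Hom Z A) (v : Hom Z B) (e : f ∘ u = g ∘ v), pb_fst f g ∘ pb_pair e = u;
  pb_snd_pair : forall (A B D : C) (f : Hom A D) (g : Hom B D) (Z : C)
    (u : Hom Z A) (v : Hom Z B) (e : f ∘ u = g ∘ v), pb_snd f g ∘ pb_pair e = v;
  pb_unique : forall (A B D : C) (f : Hom A D) (g : Hom B D) (Z : C)
    (h k : Hom Z (pb f g)),
    pb_fst f g ∘ h = pb_fst f g ∘ k -> pb_snd f g ∘ h = pb_snd f g ∘ k -> h = k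
}.

Section Descent.
Variables (C : Category) (P : Pullbacks C) (E B : C) (p : Hom E B).

Definition postcomp_obj (M : slice E) : slice B :=
  MkSliceObj (p ∘ slice_map M).

Definition postcomp_hom (M N : slice E) (f : Hom M N) :
  Hom (postcomp_obj M) (postcomp_obj N).
Proof.
refine (MkSliceHom (M := postcomp_obj M) (N := postcomp_obj N)
          (slice_hom := slice_hom f) _).
abstract (simpl; now rewrite <- comp_assoc, slice_hom_comm).
Defined.

(* The functor written p_! in the literature. *)
Definition postcomp_functor : Functor (slice E) (slice B).
Proof.
refine {| fobj := postcomp_obj; fmap := postcomp_hom |}.
- abstract (intros; now apply SliceHom_eq).
- abstract (intros; now apply SliceHom_eq).
Defined.

Definition pullback_obj (M : slice B) : slice E :=
  MkSliceObj (pb_fst P p (slice_map M)).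

Lemma pullback_hom_eq (M N : slice B) (f : Hom M N) :
  p ∘ pb_fst P p (slice_map M)
  = slice_map N ∘ (slice_hom f ∘ pb_snd P p (slice_map M)).
Proof. now rewrite comp_assoc, slice_hom_comm, pb_square. Qed.

Definition pullback_hom (M N : slice B) (f : Hom M N) :
  Hom (pullback_obj M) (pullback_obj N) :=
  MkSliceHom (M := pullback_obj M) (N := pullback_obj N)
    (pb_fst_pair P (pullback_hom_eq f)).

(* The functor written p^* in the literature. *)
Definition pullback_functor : Functor (slice B) (slice E).
Proof.
refine {| fobj := pullback_obj; fmap := pullback_hom |}.
- abstract (intros M; apply SliceHom_eq; apply pb_unique; simpl;
    [rewrite pb_fst_pair | rewrite pb_snd_pair, comp_idl]; now rewrite comp_idr).
- abstract (intros M N Q g f; apply SliceHom_eq; apply pb_unique; simpl;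
    [ now rewrite comp_assoc, !pb_fst_pair
    | now rewrite comp_assoc, !pb_snd_pair, <- !comp_assoc, pb_snd_pair ]).
Defined.

Lemma pullback_unit_eq (M : slice E) :
  p ∘ slice_map M = (p ∘ slice_map M) ∘ idm (slice_dom M).
Proof. now rewrite comp_idr. Qed.

Definition pullback_unit_at (M : slice E) :
  Hom M (pullback_obj (postcomp_obj M)) :=
  MkSliceHom (M := M) (N := pullback_obj (postcomp_obj M))
    (pb_fst_pair P (pullback_unit_eq M)).

Definition pullback_unit :
  NatTrans (functor_id (slice E)) (functor_comp pullback_functor postcomp_functor).
Proof.
refine (MkNatTrans (F := functor_id (slice E))
          (G := functor_comp pullback_functor postcomp_functor)
          (component := pullback_unit_at) _).
abstract (intros M N f; apply SliceHom_eq; apply pb_unique; simpl;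
  [ now rewrite !comp_assoc, !pb_fst_pair, slice_hom_comm
  | now rewrite !comp_assoc, !pb_snd_pair, <- comp_assoc, pb_snd_pair, comp_idl,
      comp_idr ]).
Defined.

Definition pullback_counit_at (M : slice B) :
  Hom (postcomp_obj (pullback_obj M)) M :=
  MkSliceHom (M := postcomp_obj (pullback_obj M)) (N := M)
    (eq_sym (pb_square P p (slice_map M))).

Definition pullback_counit :
  NatTrans (functor_comp postcomp_functor pullback_functor) (functor_id (slice B)).
Proof.
refine (MkNatTrans (F := functor_comp postcomp_functor pullback_functor)
          (G := functor_id (slice B)) (component := pullback_counit_at) _).
abstract (intros M N f; apply SliceHom_eq; apply pb_snd_pair).
Defined.

Definition pullback_adjunction : Adjunction postcomp_functor pullback_functor.
Proof.
refine {| adj_unit := pullback_unit; adj_counit := pullback_counit |}.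
- abstract (intros M; apply SliceHom_eq; apply pb_snd_pair).
- abstract (intros M; apply SliceHom_eq; apply pb_unique; simpl;
    [ now rewrite comp_assoc, !pb_fst_pair, comp_idr
    | now rewrite comp_assoc, !pb_snd_pair, <- comp_assoc, pb_snd_pair ]).
Defined.

(* As a property of p this does not depend on the chosen pullbacks P. *)
Definition effective_descent : Prop := is_monadic pullback_adjunction.
End Descent.

Declare Scope preorder_scope.
Delimit Scope preorder_scope with preorder.
Local Open Scope preorder_scope.

Record Preorder : Type := MkPreorder {
  carrier :> Type;
  le : carrier -> carrier -> Prop;
  le_preorder : PreOrder le
}.
Arguments le {_} _ _.
Notation "a ≤ b" := (le a b) (at level 70, no associativity) : preorder_scope.

(* [filt A x a] stands for (x, a) ∈ 𝖺, that is, a ∈ A_x. *)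
Record FilteredPreorder (X : Preorder) : Type := MkFilteredPreorder {
  fp_preorder :> Preorder;
  filt : X -> fp_preorder -> Prop;
  filt_closed : forall (x x' : X) (a a' : fp_preorder),
    x' ≤ x -> a ≤ a' -> filt x a -> filt x' a'
}.
Arguments filt {X} A x a : rename.

Section FilteredCategory.
Variable X : Preorder.

Record FilteredHom (A B : FilteredPreorder X) : Type := MkFilteredHom {
  fun_of :> A -> B;
  monotone : forall a a' : A, a ≤ a' -> fun_of a ≤ fun_of a';
  filtered : forall (x : X) (a : A), filt A x a -> filt B x (fun_of a)
}.

Lemma FilteredHom_eq (A B : FilteredPreorder X) (f g : FilteredHom A B) :
  (forall a : A, f a = g a) -> f = g.
Proof.
destruct f as [f Hf Kf], g as [g Hg Kg]; simpl; intros Hfg.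
apply functional_extensionality in Hfg; subst g.
f_equal; apply proof_irrelevance.
Qed.

Definition filtered_id (A : FilteredPreorder X) : FilteredHom A A :=
  {| fun_of := fun a => a;
     monotone := fun _ _ H => H;
     filtered := fun _ _ H => H |}.

Definition filtered_comp (A B C : FilteredPreorder X)
  (g : FilteredHom B C) (f : FilteredHom A B) : FilteredHom A C :=
  {| fun_of := fun a => g (f a);
     monotone := fun _ _ H => monotone g (monotone f H);
     filtered := fun _ _ H => filtered g (filtered f H) |}.

Definition FilteredOrd : Category.
Proof.
refine {| Obj := FilteredPreorder X; Hom := FilteredHom;
          idm := filtered_id; comp := filtered_comp |}.
- abstract (intros; now apply FilteredHom_eq).
- abstract (intros; now apply FilteredHom_eq).
- abstract (intros; now apply FilteredHom_eq).
Defined.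

Section Pullback.
Variables (A B D : FilteredPreorder X) (f : FilteredHom A D) (g : FilteredHom B D).

Definition fpb_carrier : Type := {ab : A * B | f (fst ab) = g (snd ab)}.

Definition fpb_le (u v : fpb_carrier) : Prop :=
  fst (proj1_sig u) ≤ fst (proj1_sig v) /\ snd (proj1_sig u) ≤ snd (proj1_sig v).

Lemma fpb_le_preorder : PreOrder fpb_le.
Proof.
destruct (le_preorder A) as [rA tA], (le_preorder B) as [rB tB].
split.
- intros u; split; [apply rA | apply rB].
- intros u v w [H1 H2] [K1 K2]; split; [eapply tA | eapply tB]; eassumption.
Qed.

Definition fpb_preorder : Preorder := MkPreorder fpb_le_preorder.

Definition fpb_filt (x : X) (u : fpb_preorder) : Prop :=
  filt A x (fst (proj1_sig u)) /\ filt B x (snd (proj1_sig u)).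

Lemma fpb_filt_closed (x x' : X) (u u' : fpb_preorder) :
  x' ≤ x -> u ≤ u' -> fpb_filt x u -> fpb_filt x' u'.
Proof.
intros Hx [H1 H2] [K1 K2]; split; eapply filt_closed; eassumption.
Qed.

Definition fpb : FilteredPreorder X := MkFilteredPreorder fpb_filt_closed.

Lemma fpb_eq (u v : fpb) : fst (proj1_sig u) = fst (proj1_sig v) ->
  snd (proj1_sig u) = snd (proj1_sig v) -> u = v.
Proof.
destruct u as [[a b] e], v as [[a' b'] e']; simpl; intros <- <-.
f_equal; apply proof_irrelevance.
Qed.

Definition fpb_fst : FilteredHom fpb A :=
  MkFilteredHom (A := fpb) (fun_of := fun u : fpb => fst (proj1_sig u))
    (fun _ _ => @proj1 _ _) (fun _ _ => @proj1 _ _).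

Definition fpb_snd : FilteredHom fpb B :=
  MkFilteredHom (A := fpb) (fun_of := fun u : fpb => snd (proj1_sig u))
    (fun _ _ => @proj2 _ _) (fun _ _ => @proj2 _ _).

Lemma fpb_square : filtered_comp f fpb_fst = filtered_comp g fpb_snd.
Proof. apply FilteredHom_eq; intros u; exact (proj2_sig u). Qed.

Definition fpb_pair (Z : FilteredPreorder X) (u : FilteredHom Z A) (v : FilteredHom Z B)
  (e : filtered_comp f u = filtered_comp g v) : FilteredHom Z fpb :=
  MkFilteredHom (B := fpb)
    (fun_of := fun z => exist (fun ab : A * B => f (fst ab) = g (snd ab)) (u z, v z)
       (f_equal (fun h : FilteredHom Z D => h z) e))
    (fun _ _ H => conj (monotone u H) (monotone v H))
    (fun _ _ H => conj (filtered u H) (filtered v H)).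
End Pullback.

Definition FilteredOrd_pullbacks : Pullbacks FilteredOrd.
Proof.
refine (MkPullbacks (C := FilteredOrd) (pb := fpb) (pb_fst := fpb_fst) (pb_snd := fpb_snd)
          (pb_pair := fpb_pair) fpb_square _ _ _).
- abstract (intros; now apply FilteredHom_eq).
- abstract (intros; now apply FilteredHom_eq).
- abstract (intros A B D f g Z h k H1 H2; apply FilteredHom_eq; intros z;
    apply fpb_eq;
    [ exact (f_equal (fun m : FilteredHom Z A => m z) H1)
    | exact (f_equal (fun m : FilteredHom Z B => m z) H2) ]).
Defined.
End FilteredCategory.

(* Main.v *)
(** Necessity: an equivalence reflects isomorphisms.  Two filtered preorders over B with
    the same points, one of which only keeps the relations that lift along p, become
    isomorphic over E, hence they agree; this lifts single inequalities b1 <= b0 and single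
    points of B_x.  Next, on {(e,i) | p e = beta i} with i in a small index set one puts
    an order (resp. a filtration) that is closed under transitivity (resp. up-closed)
    fibrewise over E, but imposes 2 <= 0 (resp. 0 in the filtration) only if the chain
    (resp. the pair in E_x) lifts.  This is an algebra, so it comes from some D over B, in
    which the relation in question holds automatically; hence the lift exists.

    Sufficiency: an algebra g : C -> E with action (e,c) |-> ec descends to the quotient of
    C identifying c with ec, where two classes are related when some representatives are.
    Lifting of chains gives transitivity, lifting of pairs in E_x gives up-closedness.  The
    quotient is realised as {c | g c = s (p (g c))} for a section s of p. *)
From Stdlib Require Import ProofIrrelevance IndefiniteDescription.
Require Import Defs.

Open Scope preorder_scope.

Set Implicit Arguments.
Unset Strict Implicit.
Unset Printing Implicit Defensive.

(** * Reflection of isomorphisms in general categories *)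

Lemma is_iso_cancel_r (C : Category) (A B D : C) (g : Hom B D) (f : Hom A B) :
  is_iso f -> is_iso (comp g f) -> is_iso g.
Proof.
intros [f' [Hl Hr]] [k [Kl Kr]].
assert (E : comp f (comp k g) = idm B).
{ rewrite <- (comp_idr (comp f (comp k g))), <- Hr, !comp_assoc.
  rewrite <- (comp_assoc (comp f k)), <- (comp_assoc f k), Kl, comp_idr.
  reflexivity. }
exists (comp f k); split.
- now rewrite <- comp_assoc.
- now rewrite comp_assoc.
Qed.

Lemma is_iso_comp (C : Category) (A B D : C) (g : Hom B D) (f : Hom A B) :
  is_iso g -> is_iso f -> is_iso (comp g f).
Proof.
intros [g' [Gl Gr]] [f' [Fl Fr]].
exists (comp f' g'); split.
- now rewrite comp_assoc, <- (comp_assoc f'), Gl, comp_idr.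
- now rewrite comp_assoc, <- (comp_assoc g), Fr, comp_idr.
Qed.

Lemma fmap_is_iso (C D : Category) (F : Functor C D) (A B : C) (f : Hom A B) :
  is_iso f -> is_iso (fmap F f).
Proof.
intros [g [Hl Hr]]; exists (fmap F g).
now rewrite <- !fmap_comp, Hl, Hr, !fmap_id.
Qed.

(** Naturality of the isomorphism [alpha] from [G F] to the identity gives
    [f ∘ alpha A = alpha B ∘ G (F f)]. The right side is invertible, and [alpha A] cancels. *)
Lemma equivalence_reflects_iso (C D : Category) (F : Functor C D) (A B : C)
  (f : Hom A B) : is_equivalence F -> is_iso (fmap F f) -> is_iso f.
Proof.
intros [G [[alpha Halpha] _]] Hf.
apply (is_iso_cancel_r (Halpha A)).
change (is_iso (comp (fmap (functor_id C) f) (alpha A))).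
rewrite <- naturality.
apply is_iso_comp; [apply Halpha |].
exact (fmap_is_iso G Hf).
Qed.

Lemma alg_hom_reflects_iso (C : Category) (T : Monad C) (M N : algebra_category T)
  (f : Hom M N) : is_iso (alg_hom f) -> is_iso f.
Proof.
intros [g [Hl Hr]].
assert (Hg : comp g (alg_act N) = comp (alg_act M) (fmap T g)).
{ rewrite <- (comp_idr (alg_act N)), <- (fmap_id T), <- Hr, fmap_comp.
  rewrite (comp_assoc (alg_act N)), <- alg_hom_comm.
  now rewrite !comp_assoc, Hl, comp_idl. }
exists (MkAlgHom Hg : @Hom (algebra_category T) N M).
split; now apply AlgHom_eq.
Qed.

Lemma slice_hom_reflects_iso (C : Category) (B : C) (M N : slice B) (f : Hom M N) :
  is_iso (slice_hom f) -> is_iso f.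
Proof.
intros [g [Hl Hr]].
assert (Hg : comp (slice_map M) g = slice_map N).
{ now rewrite <- (slice_hom_comm f), <- comp_assoc, Hr, comp_idr. }
exists (MkSliceHom Hg : @Hom (slice B) N M).
split; now apply SliceHom_eq.
Qed.

(** The pullback functor is the comparison functor followed by the forgetful functor from algebras,
    and both reflect isomorphisms. *)
Lemma effective_descent_reflects_iso (C : Category) (P : Pullbacks C) (E B : C)
  (p : Hom E B) (M N : slice B) (f : Hom M N) :
  effective_descent P p -> is_iso (fmap (pullback_functor P p) f) -> is_iso f.
Proof.
intros Hp Hf.
apply (equivalence_reflects_iso Hp), alg_hom_reflects_iso, Hf.
Qed.

Section FilteredPreorders.
Variable X : Preorder.

Lemma le_refl (A : Preorder) (a : A) : a ≤ a.
Proof. apply (le_preorder A). Qed.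

Lemma le_trans (A : Preorder) (b a c : A) : a ≤ b -> b ≤ c -> a ≤ c.
Proof. apply (le_preorder A). Qed.

Lemma filtered_is_iso (A A' : FilteredOrd X) (f : FilteredHom A A') (g : FilteredHom A' A) :
  (forall a, g (f a) = a) -> (forall a, f (g a) = a) -> @is_iso (FilteredOrd X) A A' f.
Proof. intros Hl Hr; exists g; split; now apply FilteredHom_eq. Qed.

Lemma fpb_fun_eq (A A' D Z : FilteredPreorder X) (f : FilteredHom A D)
  (f' : FilteredHom A' D) (h : FilteredHom (fpb f f') Z) (u v : fpb f f') :
  fst (proj1_sig u) = fst (proj1_sig v) -> snd (proj1_sig u) = snd (proj1_sig v) ->
  h u = h v.
Proof. intros; f_equal; now apply fpb_eq. Qed.

Definition slice_fun (A : FilteredOrd X) (M N : slice A) (f : SliceHom M N) :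
  FilteredHom (slice_dom M) (slice_dom N) := slice_hom f.

Lemma slice_fun_eq (A : FilteredOrd X) (M N : slice A) (f g : SliceHom M N)
  (a : (slice_dom M : FilteredPreorder X)) : f = g -> slice_fun f a = slice_fun g a.
Proof. now intros ->. Qed.

Variables (E B : FilteredPreorder X) (p : FilteredHom E B).
Let P := FilteredOrd_pullbacks X.
Let descent_monad : Monad (@slice (FilteredOrd X) E) :=
  adjunction_monad (pullback_adjunction (C := FilteredOrd X) P p).

Definition slice_over (Q : FilteredPreorder X) (m : FilteredHom Q B) :
  @slice (FilteredOrd X) B := @MkSliceObj (FilteredOrd X) B Q m.

(** * Necessity: lifting of single points and single inequalities *)

Section Necessity.
Hypothesis p_descent : effective_descent (C := FilteredOrd X) P p.

(* The hypotheses say that g becomes a morphism p^*Q' -> p^*Q. *)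
Lemma effective_descent_reflects_structure (Q Q' : FilteredPreorder X)
  (f : FilteredHom Q Q') (g : Q' -> Q) (m : FilteredHom Q' B) :
  (forall q, g (f q) = q) -> (forall q, f (g q) = q) ->
  (forall e e' q q', p e = m q -> p e' = m q' -> e ≤ e' -> q ≤ q' -> g q ≤ g q') ->
  (forall x e q, p e = m q -> filt E x e -> filt Q' x q -> filt Q x (g q)) ->
  (forall q q', q ≤ q' -> g q ≤ g q') /\
  (forall x q, filt Q' x q -> filt Q x (g q)).
Proof.
intros gf fg Hle Hfilt.
set (h := @MkSliceHom (FilteredOrd X) B (slice_over (filtered_comp m f)) (slice_over m)
            f eq_refl : @Hom (slice _) _ _).
assert (Hh : is_iso h).
{ apply (effective_descent_reflects_iso p_descent), slice_hom_reflects_iso.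
  assert (He : forall u : fpb p m,
    p (fst (proj1_sig u)) = filtered_comp m f (g (snd (proj1_sig u)))).
  { intros u; simpl; rewrite fg; exact (proj2_sig u). }
  set (k := fun u : fpb p m =>
    exist (fun ab => p (fst ab) = filtered_comp m f (snd ab))
      (fst (proj1_sig u), g (snd (proj1_sig u))) (He u) : fpb p (filtered_comp m f)).
  assert (k_mono : forall u v, u ≤ v -> k u ≤ k v).
  { intros u v [H1 H2]; split; [exact H1 |].
    exact (Hle _ _ _ _ (proj2_sig u) (proj2_sig v) H1 H2). }
  assert (k_filt : forall x u, filt _ x u -> filt _ x (k u)).
  { intros x u [H1 H2]; split; [exact H1 |].
    exact (Hfilt _ _ _ (proj2_sig u) H1 H2). }
  apply (filtered_is_iso (g := MkFilteredHom k_mono k_filt)).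
  - intros u; apply fpb_eq; [reflexivity | apply gf].
  - intros u; apply fpb_eq; [reflexivity | apply fg]. }
destruct Hh as [k [Hk _]].
(* The inverse of [h] and the map [g] both invert [f], so they agree on points and [g] inherits the
   structure preservation of a morphism. *)
set (k0 := slice_hom k : FilteredHom Q' Q).
assert (k_g : forall q, k0 q = g q).
{ intros q; rewrite <- (fg q) at 1.
  exact (slice_fun_eq (M := slice_over (filtered_comp m f)) (g q) Hk). }
split.
- intros q q' H; rewrite <- !k_g; now apply monotone.
- intros x q H; rewrite <- k_g; now apply filtered.
Qed.

(** On the discrete order of [B], the filtration by the images of the [E_x] is compared with the one
    by the [B_x]. They agree after pullback, because a pair [(e, b)] with [e] in [E_x] already
    exhibits [b] in the image. *)
Lemma effective_descent_lifts_filt (x : X) (b : B) :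
  filt B x b -> exists e, filt E x e /\ p e = b.
Proof.
assert (eq_preorder : RelationClasses.PreOrder (@eq B)) by (split; congruence).
set (D := MkPreorder eq_preorder).
assert (HQ : forall (x x' : X) (b b' : D), x' ≤ x -> b ≤ b' ->
  (exists e, filt E x e /\ p e = b) -> exists e, filt E x' e /\ p e = b').
{ intros y y' c c' Hy <- [e [He Hc]]; exists e; split; [| exact Hc].
  exact (filt_closed Hy (le_refl e) He). }
assert (HQ' : forall (x x' : X) (b b' : D), x' ≤ x -> b ≤ b' ->
  filt B x b -> filt B x' b').
{ intros y y' c c' Hy <-; exact (filt_closed Hy (le_refl (c : B))). }
set (Q := MkFilteredPreorder HQ); set (Q' := MkFilteredPreorder HQ').
assert (f_filt : forall x (q : Q), filt Q x q -> filt Q' x q).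
{ intros y c [e [He Hc]]; exact (eq_ind _ (filt B y) (filtered p He) _ Hc). }
assert (m_mono : forall q q' : Q', q ≤ q' -> (q : B) ≤ q').
{ intros c c' <-; apply le_refl. }
set (f := MkFilteredHom (A := Q) (B := Q') (fun_of := fun q => q) (fun _ _ H => H) f_filt).
set (m := MkFilteredHom (A := Q') (B := B) (fun_of := fun q => q) m_mono (fun _ _ H => H)).
refine (proj2 (@effective_descent_reflects_structure Q Q' f (fun q => q) m _ _ _ _) x b).
- reflexivity.
- reflexivity.
- intros; assumption.
- intros y e q Hq He _; exists e; now split.
Qed.

(* The arrow true <= false is present only if R holds. *)
Definition arrow_le (R : Prop) (i j : bool) : Prop := i = j \/ (i = true /\ j = false /\ R).

Lemma arrow_le_preorder (R : Prop) : RelationClasses.PreOrder (arrow_le R).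
Proof.
split.
- now left.
- intros i j k [<- | [Hi [Hj HR]]] H; [exact H |].
  destruct H as [<- | [Hj' _]]; [right; auto | congruence].
Qed.

Definition arrow (R : Prop) : FilteredPreorder X :=
  @MkFilteredPreorder X (MkPreorder (arrow_le_preorder R)) (fun _ _ => False)
    (fun _ _ _ _ _ _ H => H).

(** With [R] the existence of a lift, [arrow R] and [arrow True] have the same pullback: any
    [e ≤ e'] over the nontrivial arrow is itself a proof of [R]. *)
Lemma effective_descent_lifts_le (b0 b1 : B) :
  b1 ≤ b0 -> exists e0 e1, e1 ≤ e0 /\ p e0 = b0 /\ p e1 = b1.
Proof.
intros Hb.
set (R := exists e0 e1, e1 ≤ e0 /\ p e0 = b0 /\ p e1 = b1).
set (b := fun i : bool => if i then b1 else b0).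
assert (f_mono : forall q q' : arrow R, q ≤ q' -> (q : arrow True) ≤ (q' : arrow True)).
{ intros i j [H | [Hi [Hj _]]]; [now left | right; auto]. }
assert (m_mono : forall q q' : arrow True, q ≤ q' -> b q ≤ b q').
{ intros i j [<- | [-> [-> _]]]; [apply le_refl | exact Hb]. }
set (f := MkFilteredHom (A := arrow R) (B := arrow True) (fun_of := fun q => q)
            f_mono (fun _ _ H => H)).
set (m := MkFilteredHom (A := arrow True) (B := B) (fun_of := b) m_mono
            (fun _ _ H => match H with end)).
assert (H : (true : arrow R) ≤ (false : arrow R)).
{ refine (proj1 (@effective_descent_reflects_structure _ _ f (fun q => q) m _ _ _ _)
            true false _).
  - reflexivity.
  - reflexivity.
  - intros e e' i j He He' Hee [<- | [-> [-> _]]]; [now left | right].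
    repeat split; now exists e', e.
  - intros x e i _ _ [].
  - right; auto. }
destruct H as [H | [_ [_ H]]]; [discriminate | exact H].
Qed.

(* R and F need not be transitive, resp. up-closed: only over comparable points of E.
   Hence the algebra below need not be the pullback of a structure on I. *)
Section LocalStructure.
Variables (I : Type) (beta : I -> B) (R : I -> I -> Prop) (F : X -> I -> Prop).
Hypothesis R_refl : forall i, R i i.
Hypothesis R_trans : forall e e' e'' i j k,
  p e = beta i -> p e' = beta j -> p e'' = beta k ->
  e ≤ e' -> e' ≤ e'' -> R i j -> R j k -> R i k.
Hypothesis F_closed : forall x x' e e' i j,
  p e = beta i -> p e' = beta j -> x' ≤ x -> e ≤ e' -> R i j ->
  filt E x e -> F x i -> F x' j.

Definition local_carrier : Type := {ei : E * I | p (fst ei) = beta (snd ei)}.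

Definition local_le (u v : local_carrier) : Prop :=
  fst (proj1_sig u) ≤ fst (proj1_sig v) /\ R (snd (proj1_sig u)) (snd (proj1_sig v)).

Lemma local_le_preorder : RelationClasses.PreOrder local_le.
Proof.
split.
- intros u; split; [apply le_refl | apply R_refl].
- intros u v w [H1 H2] [K1 K2]; split; [exact (le_trans H1 K1) |].
  exact (R_trans (proj2_sig u) (proj2_sig v) (proj2_sig w) H1 K1 H2 K2).
Qed.

Definition local_preorder : Preorder := MkPreorder local_le_preorder.

Definition local_filt (x : X) (u : local_preorder) : Prop :=
  filt E x (fst (proj1_sig u)) /\ F x (snd (proj1_sig u)).

Lemma local_filt_closed (x x' : X) (u u' : local_preorder) :
  x' ≤ x -> u ≤ u' -> local_filt x u -> local_filt x' u'.
Proof.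
intros Hx [H1 H2] [K1 K2]; split.
- exact (filt_closed Hx H1 K1).
- exact (F_closed (proj2_sig u) (proj2_sig u') Hx H1 H2 K1 K2).
Qed.

Definition local_pb : FilteredPreorder X := MkFilteredPreorder local_filt_closed.

Lemma local_eq (u v : local_pb) : fst (proj1_sig u) = fst (proj1_sig v) ->
  snd (proj1_sig u) = snd (proj1_sig v) -> u = v.
Proof.
destruct u as [[e i] H], v as [[e' i'] H']; simpl; intros <- <-.
f_equal; apply proof_irrelevance.
Qed.

Definition local_map : FilteredHom local_pb E :=
  MkFilteredHom (A := local_pb) (fun_of := fun u : local_pb => fst (proj1_sig u))
    (fun _ _ => @proj1 _ _) (fun _ _ => @proj1 _ _).

Let local_slice : @slice (FilteredOrd X) E := @MkSliceObj (FilteredOrd X) E local_pb local_map.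
Let TC : FilteredPreorder X := fpb p (filtered_comp p local_map).

Lemma local_act_eq (u : TC) :
  p (fst (proj1_sig u)) = beta (snd (proj1_sig (snd (proj1_sig u)))).
Proof. exact (eq_trans (proj2_sig u) (proj2_sig (snd (proj1_sig u)))). Qed.

Definition local_act_fun (u : TC) : local_pb :=
  exist (fun ei => p (fst ei) = beta (snd ei))
    (fst (proj1_sig u), snd (proj1_sig (snd (proj1_sig u)))) (local_act_eq u).

Definition local_act : FilteredHom TC local_pb :=
  MkFilteredHom (A := TC) (B := local_pb) (fun_of := local_act_fun)
    (fun _ _ H => conj (proj1 H) (proj2 (proj2 H)))
    (fun _ _ H => conj (proj1 H) (proj2 (proj2 H))).

(** This is the canonical descent datum on a pullback. The algebra laws are equations between
    points, so they hold whatever [R] and [F] are; these only enter the order and the filtration. *)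
Definition local_algebra : Algebra descent_monad.
Proof.
unshelve refine (@MkAlgebra _ descent_monad local_slice
  (@MkSliceHom (FilteredOrd X) E (descent_monad local_slice) local_slice local_act _) _ _).
- now apply FilteredHom_eq.
- apply SliceHom_eq, FilteredHom_eq; intros u; now apply local_eq.
- apply SliceHom_eq, FilteredHom_eq; intros u; apply local_eq; cbn; reflexivity.
Defined.

(** Only essential surjectivity of the comparison functor is used: the local algebra is isomorphic
    to the pullback of some [D], and [R] and [F] are read off through the isomorphism. The section
    [s] only provides one point in each fibre. *)
Lemma local_structure_descends (s : I -> E) : (forall i, p (s i) = beta i) ->
  exists (D : FilteredPreorder X) (m : FilteredHom D B) (d : I -> D),
    (forall e e' i j, p e = beta i -> p e' = beta j -> e ≤ e' ->
       (R i j <-> d i ≤ d j)) /\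
    (forall x e i, p e = beta i -> filt E x e -> (F x i <-> filt D x (d i))).
Proof.
intros Hs.
destruct p_descent as [G [_ [alpha Halpha]]].
destruct (Halpha local_algebra) as [psi [Hl Hr]].
set (Y := G local_algebra) in *.
set (D := slice_dom Y : FilteredPreorder X).
set (m := slice_map Y : FilteredHom D B).
set (a := slice_hom (alg_hom (alpha local_algebra)) : FilteredHom (fpb p m) local_pb).
set (b := slice_hom (alg_hom psi) : FilteredHom local_pb (fpb p m)).
assert (ab : forall u, a (b u) = u).
{ intros u; exact (slice_fun_eq (M := local_slice) u (f_equal (@alg_hom _ _ _ _) Hr)). }
assert (b_fst : forall u, fst (proj1_sig (b u)) = fst (proj1_sig u)).
{ intros u.
  exact (f_equal (fun t : FilteredHom local_pb E => t u) (slice_hom_comm (alg_hom psi))). }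
(* The action on the pullback of [D] leaves the [D]-coordinate alone, so equivariance makes that
   coordinate of [b] independent of the point of [E]. *)
assert (b_act : forall u : TC, snd (proj1_sig (b (local_act u)))
                             = snd (proj1_sig (b (snd (proj1_sig u))))).
{ intros u.
  exact (f_equal (fun v : fpb p m => snd (proj1_sig v))
          (slice_fun_eq (M := descent_monad local_slice) u (alg_hom_comm psi))). }
set (pt := fun e i (H : p e = beta i) =>
  exist (fun ei => p (fst ei) = beta (snd ei)) (e, i) H : local_pb).
set (d := fun i => snd (proj1_sig (b (pt (s i) i (Hs i))))).
assert (b_snd : forall e i H, snd (proj1_sig (b (pt e i H))) = d i).
{ intros e i H.
  set (u := exist (fun ab => p (fst ab) = filtered_comp p local_map (snd ab))
              (e, pt (s i) i (Hs i)) (eq_trans H (eq_sym (Hs i))) : TC).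
  refine (eq_trans _ (b_act u)); do 3 f_equal; now apply local_eq. }
exists D, m, d; split.
- intros e e' i j H H' He; split.
  + intros HR; rewrite <- (b_snd _ _ H), <- (b_snd _ _ H').
    refine (proj2 (monotone b (a := pt e i H) (a' := pt e' j H') _)); now split.
  + intros Hd.
    assert (K : b (pt e i H) ≤ b (pt e' j H')).
    { split; [now rewrite !b_fst | now rewrite !b_snd]. }
    apply (monotone a) in K; rewrite !ab in K; exact (proj2 K).
- intros x e i H He; split.
  + intros HF; rewrite <- (b_snd _ _ H).
    refine (proj2 (filtered b (a := pt e i H) _)); now split.
  + intros Hd.
    assert (K : filt _ x (b (pt e i H))).
    { split; [now rewrite b_fst | now rewrite b_snd]. }
    apply (filtered a) in K; rewrite ab in K; exact (proj2 K).
Qed.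
End LocalStructure.

(** * Necessity: lifting of chains and of filtered pairs *)

Lemma effective_descent_lifts_chain (b0 b1 b2 : B) : b2 ≤ b1 -> b1 ≤ b0 ->
  exists e0 e1 e2, e2 ≤ e1 /\ e1 ≤ e0 /\ p e0 = b0 /\ p e1 = b1 /\ p e2 = b2.
Proof.
intros H21 H10.
set (S := exists e0 e1 e2, e2 ≤ e1 /\ e1 ≤ e0 /\ p e0 = b0 /\ p e1 = b1 /\ p e2 = b2).
(* The indices 0, 1, 2 are encoded as [None], [Some false], [Some true]. *)
set (beta := fun i : option bool =>
  match i with None => b0 | Some false => b1 | Some true => b2 end).
set (R := fun i j : option bool =>
  match i, j with
  | None, None | Some false, None => True
  | Some true, None => S
  | None, Some _ | Some false, Some true => False
  | Some _, Some _ => True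
  end).
destruct (effective_descent_lifts_le H21) as [f1 [f2 [Hf [Hf1 Hf2]]]].
destruct (effective_descent_lifts_le H10) as [g0 [g1 [Hg [Hg0 Hg1]]]].
destruct (effective_descent_lifts_le (le_trans H21 H10)) as [h0 [h2 [Hh [Hh0 Hh2]]]].
destruct (@local_structure_descends (option bool) beta R (fun _ _ => False)) with
  (s := fun i : option bool =>
     match i with None => g0 | Some false => f1 | Some true => f2 end)
  as [D [m [d [Hd _]]]].
- now intros [[] |].
(* The only composite not settled by logic is 2 ≤ 1 ≤ 0, where the three points of [E] form the
   lifted chain demanded by [S]. *)
- intros e e' e'' [[] |] [[] |] [[] |] Hi Hj Hk K L; simpl; try tauto.
  intros _ _; now exists e'', e', e.
- intros x x' e e' i j _ _ _ _ _ _ [].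
- now intros [[] |].
(* Transitivity in [D] gives [d 2 ≤ d 0]; tested over [h2 ≤ h0], this says that [R] relates 2 to 0,
   which is [S]. *)
- refine (proj2 (Hd h2 h0 (Some true) None Hh2 Hh0 Hh) _).
  apply (le_trans (b := d (Some false))).
  + exact (proj1 (Hd f2 f1 (Some true) (Some false) Hf2 Hf1 Hf) I).
  + exact (proj1 (Hd g1 g0 (Some false) None Hg1 Hg0 Hg) I).
Qed.

Lemma effective_descent_lifts_filt_le (x : X) (b0 b1 : B) :
  filt B x b0 -> filt B x b1 -> b1 ≤ b0 ->
  exists e0 e1, filt E x e0 /\ filt E x e1 /\ e1 ≤ e0 /\ p e0 = b0 /\ p e1 = b1.
Proof.
intros Hx0 Hx1 H10.
set (S := fun x => exists e0 e1,
  filt E x e0 /\ filt E x e1 /\ e1 ≤ e0 /\ p e0 = b0 /\ p e1 = b1).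
set (beta := fun i : bool => if i then b1 else b0).
destruct (effective_descent_lifts_le H10) as [e0 [e1 [He [He0 He1]]]].
destruct (effective_descent_lifts_filt Hx0) as [f0 [Hf0 Kf0]].
destruct (effective_descent_lifts_filt Hx1) as [f1 [Hf1 Kf1]].
destruct (@local_structure_descends bool beta (arrow_le True) (fun x i => i = true \/ S x)) with
  (s := fun i : bool => if i then e1 else e0) as [D [m [d [Hd Kd]]]].
- now left.
- intros e e' e'' i j k _ _ _ _ _; apply (arrow_le_preorder True).
- intros y y' e e' i j Hi Hj Hy Hee Hij Ke [-> | [g0 [g1 [K0 [K1 K]]]]].
  + destruct Hij as [<- | [_ [-> _]]]; [now left | right].
    (* Up-closedness of the filtration on [E] puts [e'] next to [e], so the comparable pair at hand
       is the lift required by [S]. *)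
    exists e', e; repeat split; trivial.
    * exact (filt_closed Hy Hee Ke).
    * exact (filt_closed Hy (le_refl e) Ke).
  + right; exists g0, g1; split; [| split; [| exact K]].
    * exact (filt_closed Hy (le_refl g0) K0).
    * exact (filt_closed Hy (le_refl g1) K1).
- now intros [].
(* Up-closedness in [D] carries membership from [d true] to [d false]. Testing it at [f0], a point
   of [E_x] over [b0], leaves only the alternative [S x]. *)
- assert (K : filt D x (d false)).
  { apply (filt_closed (le_refl x) (a := d true)).
    - refine (proj1 (Hd e1 e0 true false He1 He0 He) _); right; auto.
    - refine (proj1 (Kd x f1 true Kf1 Hf1) _); now left. }
  destruct (proj2 (Kd x f0 false Kf0 Hf0) K); [discriminate | assumption].
Qed.
End Necessity.

(** * Sufficiency: descending the carrier of an algebra *)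

Section Sufficiency.
Hypothesis lifts_chain : forall b0 b1 b2 : B, b2 ≤ b1 -> b1 ≤ b0 ->
  exists e0 e1 e2 : E, e2 ≤ e1 /\ e1 ≤ e0 /\ p e0 = b0 /\ p e1 = b1 /\ p e2 = b2.
Hypothesis lifts_filt_le : forall (x : X) (b0 b1 : B),
  filt B x b0 -> filt B x b1 -> b1 ≤ b0 ->
  exists e0 e1 : E, filt E x e0 /\ filt E x e1 /\ e1 ≤ e0 /\ p e0 = b0 /\ p e1 = b1.
Variable s : B -> E.
Hypothesis ps : forall b, p (s b) = b.

Section DescendedObject.
Variables (C : FilteredPreorder X) (g : FilteredHom C E)
  (xi : FilteredHom (fpb p (filtered_comp p g)) C).

Definition act (e : E) (c : C) (H : p e = p (g c)) : C :=
  xi (exist (fun ec => p (fst ec) = filtered_comp p g (snd ec)) (e, c) H).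

Hypothesis g_act : forall e c H, g (@act e c H) = e.
Hypothesis act_unit : forall c, @act (g c) c eq_refl = c.
Hypothesis act_act : forall e e' c H H' H'',
  @act e' (@act e c H) H' = @act e' c H''.

Lemma act_eq e e' c c' H H' : e = e' -> c = c' -> @act e c H = @act e' c' H'.
Proof. intros -> ->; unfold act; do 2 f_equal; apply proof_irrelevance. Qed.

Lemma act_g e c H : e = g c -> @act e c H = c.
Proof. intros He; rewrite <- (act_unit c) at 2; now apply act_eq. Qed.

Lemma act_le e e' c c' H H' : e ≤ e' -> c ≤ c' -> @act e c H ≤ @act e' c' H'.
Proof. now intros; apply monotone. Qed.

Lemma act_filt x e c H : filt E x e -> filt C x c -> filt C x (@act e c H).
Proof. now intros; apply (filtered xi). Qed.

Definition desc_carrier : Type := {c : C | g c = s (p (g c))}.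

Lemma desc_carrier_eq (u v : desc_carrier) : proj1_sig u = proj1_sig v -> u = v.
Proof.
destruct u as [c H], v as [c' H']; simpl; intros <-.
f_equal; apply proof_irrelevance.
Qed.

Definition desc_le (u v : desc_carrier) : Prop :=
  exists e e' H H', @act e (proj1_sig u) H ≤ @act e' (proj1_sig v) H'.

(** The relation does not depend on the witnesses: acting once more by [e ≤ e'] moves them from [f],
    [f'] to [e], [e'], since an iterated action only remembers its last point. *)
Lemma act_desc_le e e' u v H H' : desc_le u v -> e ≤ e' ->
  @act e (proj1_sig u) H ≤ @act e' (proj1_sig v) H'.
Proof.
intros [f [f' [K [K' L]]]] He.
assert (J : p e = p (g (act K))) by now rewrite g_act, K.
assert (J' : p e' = p (g (act K'))) by now rewrite g_act, K'.
rewrite <- (act_act J H), <- (act_act J' H').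
now apply act_le.
Qed.

Lemma desc_le_base u v : desc_le u v -> p (g (proj1_sig u)) ≤ p (g (proj1_sig v)).
Proof.
intros [e [e' [H [H' L]]]].
rewrite <- H, <- H', <- (g_act H), <- (g_act H').
now apply monotone, monotone.
Qed.

Lemma desc_le_preorder : RelationClasses.PreOrder desc_le.
Proof.
split.
- intros u; exists _, _, eq_refl, eq_refl; apply le_refl.
- intros u v w Huv Hvw.
  (* The points are named in the order of the chain: [e0] lies over [u], [e1] over [v], [e2] over
     [w]. Acting on [v] by [e1] gives the common middle term. *)
  destruct (lifts_chain (desc_le_base Huv) (desc_le_base Hvw))
    as [e2 [e1 [e0 [L1 [L2 [H2 [H1 H0]]]]]]].
  exists e0, e2, H0, H2.
  apply (le_trans (b := act H1)); now apply act_desc_le.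
Qed.

Definition desc_preorder : Preorder := MkPreorder desc_le_preorder.

Definition desc_filt (x : X) (u : desc_preorder) : Prop :=
  exists e H, filt C x (@act e (proj1_sig u) H).

Lemma act_desc_filt x e u H : filt E x e -> desc_filt x u ->
  filt C x (@act e (proj1_sig u) H).
Proof.
intros He [f [K L]].
assert (J : p e = p (g (act K))) by now rewrite g_act, K.
rewrite <- (act_act J H); now apply act_filt.
Qed.

Lemma desc_filt_base x u : desc_filt x u -> filt B x (p (g (proj1_sig u))).
Proof.
intros [e [H L]]; rewrite <- H, <- (g_act H).
now apply filtered, filtered.
Qed.

Lemma desc_filt_closed (x x' : X) (u v : desc_preorder) :
  x' ≤ x -> u ≤ v -> desc_filt x u -> desc_filt x' v.
Proof.
intros Hx Huv Hu.
pose proof (desc_le_base Huv) as Hb.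
pose proof (desc_filt_base Hu) as Fu.
(* The bases of [u] and [v] both lie in [B_x]; a lift [e ≤ e'] inside [E_x] makes [e] acting on [u]
   a point of [C_x] lying below [e'] acting on [v]. *)
destruct (lifts_filt_le (filt_closed (le_refl x) Hb Fu) Fu Hb)
  as [e' [e [Fe' [Fe [L [H' H]]]]]].
exists e', H'.
apply (filt_closed Hx (a := act H)).
- now apply act_desc_le.
- now apply act_desc_filt.
Qed.

Definition desc : FilteredPreorder X := MkFilteredPreorder desc_filt_closed.

Definition desc_map : FilteredHom desc B :=
  MkFilteredHom (A := desc) (B := B) (fun_of := fun u => p (g (proj1_sig u)))
    desc_le_base desc_filt_base.

Definition desc_out_fun (u : fpb p desc_map) : C := act (proj2_sig u).

Definition desc_out : FilteredHom (fpb p desc_map) C :=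
  MkFilteredHom (A := fpb p desc_map) (B := C) (fun_of := desc_out_fun)
    (fun u v H => act_desc_le (proj2_sig u) (proj2_sig v) (proj2 H) (proj1 H))
    (fun x u H => act_desc_filt (proj2_sig u) (proj1 H) (proj2 H)).

Lemma desc_rep_eq (c : C) :
  g (act (ps (p (g c)))) = s (p (g (act (ps (p (g c)))))).
Proof. now rewrite g_act, ps. Qed.

Definition desc_rep (c : C) : desc := exist _ (act (ps (p (g c)))) (desc_rep_eq c).

Lemma desc_rep_base (c : C) : p (g c) = desc_map (desc_rep c).
Proof. simpl; now rewrite g_act, ps. Qed.

Definition desc_in_fun (c : C) : fpb p desc_map :=
  exist (fun ab => p (fst ab) = desc_map (snd ab)) (g c, desc_rep c) (desc_rep_base c).

(** Moving [c] to its representative and back to [g c] is a single action by [g c], trivial by the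
    unit law. *)
Lemma act_desc_rep (c : C) : @act (g c) (proj1_sig (desc_rep c)) (desc_rep_base c) = c.
Proof. simpl; now rewrite (act_act _ eq_refl). Qed.

Definition desc_in : FilteredHom C (fpb p desc_map).
Proof.
refine (MkFilteredHom (A := C) (B := fpb p desc_map) (fun_of := desc_in_fun) _ _).
- intros c c' H; split; [now apply monotone |].
  exists _, _, (desc_rep_base c), (desc_rep_base c'); now rewrite !act_desc_rep.
- intros x c H; split; [now apply filtered |].
  exists _, (desc_rep_base c); now rewrite act_desc_rep.
Defined.

Lemma desc_in_out u : desc_in (desc_out u) = u.
Proof.
apply fpb_eq; simpl; [apply g_act |].
apply desc_carrier_eq; simpl; unfold desc_out_fun.
assert (J : p (s (p (g (act (proj2_sig u))))) = p (g (proj1_sig (snd (proj1_sig u))))).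
{ rewrite ps, g_act; exact (proj2_sig u). }
(* The element of [desc] already sits over the chosen point of its fibre, so normalising it again
   acts trivially. *)
rewrite (act_act _ J); apply act_g.
rewrite g_act, (proj2_sig u); symmetry; exact (proj2_sig (snd (proj1_sig u))).
Qed.

Lemma desc_out_in c : desc_out (desc_in c) = c.
Proof. exact (act_desc_rep c). Qed.
End DescendedObject.

(** * The descent functor and its composite with the comparison functor on algebras *)

Let Alg : Category := algebra_category descent_monad.

Definition alg_carrier (M : Alg) : FilteredPreorder X := slice_dom (alg_obj M).

Definition alg_base (M : Alg) : FilteredHom (alg_carrier M) E := slice_map (alg_obj M).

Definition alg_xi (M : Alg) :
  FilteredHom (fpb p (filtered_comp p (alg_base M))) (alg_carrier M) :=
  slice_hom (alg_act M).

Definition alg_fun (M N : Alg) (h : Hom M N) :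
  FilteredHom (alg_carrier M) (alg_carrier N) := slice_hom (alg_hom h).

Section AlgebraLaws.
Variable M : Alg.
Let mact := act (alg_xi M).

Lemma alg_base_act e c H : alg_base M (@mact e c H) = e.
Proof.
exact (f_equal (fun h : FilteredHom (fpb p (filtered_comp p (alg_base M))) E => h _)
         (slice_hom_comm (alg_act M))).
Qed.

Lemma alg_act_unit c : @mact (alg_base M c) c eq_refl = c.
Proof.
refine (eq_trans _ (slice_fun_eq (M := alg_obj M) c (alg_unit M))).
now apply (fpb_fun_eq (alg_xi M)).
Qed.

Lemma alg_act_act e e' c H H' H'' :
  @mact e' (@mact e c H) H' = @mact e' c H''.
Proof.
set (u := exist (fun ec => p (fst ec) = filtered_comp p (alg_base M) (snd ec)) (e, c) H
      : fpb p (filtered_comp p (alg_base M))).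
assert (K : p e' = p e) by now rewrite H', alg_base_act.
(* The associativity law is evaluated at [(e', (e, c))], an element of the twice iterated monad. *)
set (v := exist (fun ec => p (fst ec) = filtered_comp p (fpb_fst _ _) (snd ec)) (e', u) K
      : fpb p (filtered_comp p (fpb_fst p (filtered_comp p (alg_base M))))).
assert (L := slice_fun_eq (M := descent_monad (descent_monad (alg_obj M)))
               v (alg_assoc M)).
etransitivity; [| etransitivity; [exact L |]].
- now apply (fpb_fun_eq (alg_xi M)).
- now apply (fpb_fun_eq (alg_xi M)).
Qed.
End AlgebraLaws.

Lemma alg_fun_base (M N : Alg) (h : Hom M N) c : alg_base N (alg_fun h c) = alg_base M c.
Proof.
exact (f_equal (fun t : FilteredHom (alg_carrier M) E => t c)
         (slice_hom_comm (alg_hom h))).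
Qed.

Lemma alg_fun_act (M N : Alg) (h : Hom M N) e c H H' :
  alg_fun h (@act _ _ (alg_xi M) e c H) = @act _ _ (alg_xi N) e (alg_fun h c) H'.
Proof.
etransitivity; [exact (slice_fun_eq (M := descent_monad (alg_obj M)) _ (alg_hom_comm h)) |].
now apply (fpb_fun_eq (alg_xi N)).
Qed.

Definition alg_desc (M : Alg) : FilteredPreorder X :=
  desc (@alg_base_act M) (@alg_act_act M).

Definition alg_desc_map (M : Alg) : FilteredHom (alg_desc M) B :=
  desc_map (@alg_base_act M) (@alg_act_act M).

Lemma alg_desc_fun_eq (M N : Alg) (h : Hom M N) (u : alg_desc M) :
  alg_base N (alg_fun h (proj1_sig u)) = s (p (alg_base N (alg_fun h (proj1_sig u)))).
Proof. rewrite alg_fun_base; exact (proj2_sig u). Qed.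

Definition alg_desc_fun (M N : Alg) (h : Hom M N) (u : alg_desc M) : alg_desc N :=
  exist (fun c => alg_base N c = s (p (alg_base N c))) _ (alg_desc_fun_eq h u).

Lemma alg_desc_base (M N : Alg) (h : Hom M N) (u : alg_desc M) e :
  p e = p (alg_base M (proj1_sig u)) ->
  p e = p (alg_base N (proj1_sig (alg_desc_fun h u))).
Proof. simpl; now rewrite alg_fun_base. Qed.

Definition alg_desc_fhom (M N : Alg) (h : Hom M N) :
  FilteredHom (alg_desc M) (alg_desc N).
Proof.
refine (MkFilteredHom (A := alg_desc M) (B := alg_desc N) (fun_of := alg_desc_fun h) _ _).
- intros u v [e [e' [H [H' L]]]].
  exists e, e', (alg_desc_base h H), (alg_desc_base h H').
  apply (monotone (alg_fun h)) in L.
  now rewrite (alg_fun_act H (alg_desc_base h H)),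
    (alg_fun_act H' (alg_desc_base h H')) in L.
- intros x u [e [H L]].
  exists e, (alg_desc_base h H).
  apply (filtered (alg_fun h)) in L.
  now rewrite (alg_fun_act H (alg_desc_base h H)) in L.
Defined.

Definition alg_desc_hom (M N : Alg) (h : Hom M N) :
  @Hom (@slice (FilteredOrd X) B)
    (slice_over (alg_desc_map M)) (slice_over (alg_desc_map N)).
Proof.
refine (@MkSliceHom (FilteredOrd X) B (slice_over (alg_desc_map M))
  (slice_over (alg_desc_map N)) (alg_desc_fhom h) _).
abstract (apply FilteredHom_eq; intros u; simpl; now rewrite alg_fun_base).
Defined.

(** This is the quasi-inverse of the comparison functor. *)
Definition desc_functor : Functor Alg (@slice (FilteredOrd X) B).
Proof.
refine (@MkFunctor Alg (@slice (FilteredOrd X) B) (fun M => slice_over (alg_desc_map M))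
          alg_desc_hom _ _).
- abstract (intros M; apply SliceHom_eq, FilteredHom_eq; intros u;
    now apply desc_carrier_eq).
- abstract (intros L M N g f; apply SliceHom_eq, FilteredHom_eq; intros u;
    now apply desc_carrier_eq).
Defined.

Let K := comparison_functor (pullback_adjunction (C := FilteredOrd X) P p).

Definition desc_out_slice (M : Alg) :
  SliceHom (alg_obj (functor_comp K desc_functor M)) (alg_obj M).
Proof.
refine (@MkSliceHom (FilteredOrd X) E
  (alg_obj (functor_comp K desc_functor M)) (alg_obj M)
  (desc_out (@alg_base_act M) (@alg_act_act M)) _).
abstract (apply FilteredHom_eq; intros u; exact (alg_base_act _)).
Defined.

Definition desc_out_alg (M : Alg) : Hom (functor_comp K desc_functor M) M.
Proof.
refine (@MkAlgHom _ _ (functor_comp K desc_functor M) M (desc_out_slice M) _).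
abstract (apply SliceHom_eq, FilteredHom_eq; intros [[e [[e' q] H]] H'];
  symmetry; apply alg_act_act).
Defined.

Lemma desc_out_natural (M N : Alg) (h : Hom M N) :
  comp (desc_out_alg N) (fmap (functor_comp K desc_functor) h) = comp h (desc_out_alg M).
Proof.
apply AlgHom_eq, SliceHom_eq, FilteredHom_eq; intros u.
symmetry; apply alg_fun_act.
Qed.

Lemma desc_out_is_iso (M : Alg) : is_iso (desc_out_alg M).
Proof.
apply alg_hom_reflects_iso, slice_hom_reflects_iso.
apply (filtered_is_iso (g := desc_in (@alg_base_act M) (@alg_act_unit M) (@alg_act_act M))).
- apply desc_in_out.
- apply desc_out_in.
Qed.

(** * Recovering an object over [B] from its pullback *)

Section Slices.
Variable Y : @slice (FilteredOrd X) B.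
Let D : FilteredPreorder X := slice_dom Y.
Let m : FilteredHom D B := slice_map Y.

Definition desc_snd_fun (u : alg_desc (K Y)) : D :=
  snd (proj1_sig (proj1_sig u : fpb p m)).

Definition desc_snd : FilteredHom (alg_desc (K Y)) D.
Proof.
refine (MkFilteredHom (A := alg_desc (K Y)) (B := D) (fun_of := desc_snd_fun) _ _).
- intros u v [e [e' [H [H' [_ L]]]]]; exact L.
- intros x u [e [H [_ L]]]; exact L.
Defined.

Definition desc_snd_hom :
  @Hom (@slice (FilteredOrd X) B) (functor_comp desc_functor K Y) Y.
Proof.
refine (@MkSliceHom (FilteredOrd X) B (functor_comp desc_functor K Y) Y desc_snd _).
abstract (apply FilteredHom_eq; intros u; symmetry; exact (proj2_sig (proj1_sig u))).
Defined.

Definition section_pt (d : D) : fpb p m :=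
  exist (fun ab => p (fst ab) = m (snd ab)) (s (m d), d) (ps (m d)).

Lemma section_pt_eq (d : D) :
  alg_base (K Y) (section_pt d) = s (p (alg_base (K Y) (section_pt d))).
Proof. simpl; now rewrite ps. Qed.

Definition desc_section (d : D) : alg_desc (K Y) :=
  exist (fun c => alg_base (K Y) c = s (p (alg_base (K Y) c))) _ (section_pt_eq d).

Lemma desc_section_base e d : p e = m d ->
  p e = p (alg_base (K Y) (proj1_sig (desc_section d))).
Proof. intros ->; symmetry; apply ps. Qed.

Definition desc_section_hom : FilteredHom D (alg_desc (K Y)).
Proof.
refine (MkFilteredHom (A := D) (B := alg_desc (K Y)) (fun_of := desc_section) _ _).
- intros d d' H.
  (* Repeating [m d] in the chain lifts the single inequality [m d ≤ m d']. *)
  destruct (lifts_chain (le_refl (m d)) (monotone m H))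
    as [e' [e [_ [_ [L [He' [He _]]]]]]].
  exists e, e', (desc_section_base He), (desc_section_base He'); split; assumption.
- intros x d H.
  (* The constant pair at [m d] provides a point of [E_x] above it. *)
  destruct (lifts_filt_le (filtered m H) (filtered m H) (le_refl (m d)))
    as [e [_ [Fe [_ [_ [He _]]]]]].
  exists e, (desc_section_base He); split; assumption.
Defined.

Lemma desc_snd_is_iso : is_iso desc_snd_hom.
Proof.
apply slice_hom_reflects_iso.
apply (filtered_is_iso (g := desc_section_hom)).
- intros u; apply desc_carrier_eq, fpb_eq; [| reflexivity].
  refine (eq_trans _ (eq_sym (proj2_sig u))).
  exact (f_equal s (eq_sym (proj2_sig (proj1_sig u)))).
- reflexivity.
Qed.
End Slices.

Lemma desc_snd_natural (Y Z : @slice (FilteredOrd X) B) (f : Hom Y Z) :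
  comp (desc_snd_hom Z) (fmap (functor_comp desc_functor K) f) = comp f (desc_snd_hom Y).
Proof. now apply SliceHom_eq, FilteredHom_eq. Qed.

Lemma lifting_effective_descent : effective_descent (C := FilteredOrd X) P p.
Proof.
exists desc_functor; split.
- exists (MkNatTrans (F := functor_comp desc_functor K) (G := functor_id _)
            (component := desc_snd_hom) desc_snd_natural).
  apply desc_snd_is_iso.
- exists (MkNatTrans (F := functor_comp K desc_functor) (G := functor_id _)
            (component := desc_out_alg) desc_out_natural).
  apply desc_out_is_iso.
Qed.
End Sufficiency.
End FilteredPreorders.

Theorem theorem4p2 (X : Preorder) (E B : FilteredPreorder X) (p : FilteredHom E B) :
  effective_descent (C := FilteredOrd X) (FilteredOrd_pullbacks X) p <->
  (forall b0 b1 b2 : B, b2 ≤ b1 -> b1 ≤ b0 ->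
     exists e0 e1 e2 : E,
       e2 ≤ e1 /\ e1 ≤ e0 /\ p e0 = b0 /\ p e1 = b1 /\ p e2 = b2) /\
  (forall (x : X) (b0 b1 : B), filt B x b0 -> filt B x b1 -> b1 ≤ b0 ->
     exists e0 e1 : E,
       filt E x e0 /\ filt E x e1 /\ e1 ≤ e0 /\ p e0 = b0 /\ p e1 = b1).
Proof.
split.
- intros Hp; split; intros.
  + now apply effective_descent_lifts_chain.
  + now apply effective_descent_lifts_filt_le.
- intros [Ha Hb].
  (* Condition (a) on constant chains makes [p] surjective on points; choice gives a section [s],
     with no monotonicity demanded. *)
  destruct (functional_choice (fun b e => p e = b)) as [s ps].
  { intros b; destruct (Ha b b b (le_refl b) (le_refl b)) as [e [_ [_ [_ [_ [He _]]]]]].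
    now exists e. }
  exact (lifting_effective_descent Ha Hb ps).
Qed.
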